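(* Let $h:\mathbb{C}\to\mathbb{C}$ be an affine mapping. Then $h^2$, i.e. the mapping $z\mapsto h(z)^2$, is not uniformly quasiregular.
   Context: Affine mappings are taken in the normal form $h=h_{K,\theta}$, the stretch by a factor $K>0$ in the direction $e^{i\theta}$: $h_{K,\theta}(z)=\frac{K+1}{2}z+e^{2i\theta}\frac{K-1}{2}\bar z$. Here $h^2$ denotes the pointwise square, not the second iterate. For a quasiregular map $F$ of the plane with complex dilatation $\mu_F=F_{\bar z}/F_z$, the maximal dilatation is $K(F)=\frac{1+\|\mu_F\|_\infty}{1-\|\mu_F\|_\infty}$. A quasiregular map $f:\mathbb{C}\to\mathbb{C}$ is uniformly quasiregular if there is a common bound on the maximal dilatations of all its iterates, i.e. $\sup_{n\ge1}K(f^n)<\infty$, where $f^n$ is the $n$-th iterate.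
   Formalization: The stretch factor is assumed to satisfy K ≠ 1: for K = 1 the affine mapping h is the identity and h² is z ↦ z², which is holomorphic and hence uniformly quasiregular, so the claim fails there. *)

(* Defs.v *)
From mathcomp Require Import all_boot all_order all_algebra.
From mathcomp Require Import all_classical all_reals all_analysis.
From mathcomp Require Export complex.

Set Implicit Arguments.
Unset Strict Implicit.
Unset Printing Implicit Defensive.

Import Order.TTheory GRing.Theory Num.Theory.
Import numFieldNormedType.Exports.

Local Open Scope classical_set_scope.
Local Open Scope ring_scope.
Local Open Scope complex_scope.

(* [ComplexField.Normc.normc] is the real-valued modulus on [R[i]] (the
   generic norm [`|z|] of mathcomp takes its values in [R[i]] itself). *)
Notation modulus := ComplexField.Normc.normc.

Section Plane.
Variable R : realType.
Implicit Types (F : R[i] -> R[i]) (z : R[i]).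

(* The plane carries Lebesgue measure, and its topology, through the
   identification of (x, y) : R * R with x +i* y : R[i]. *)
Definition plane_pt (p : R * R) : R[i] := p.1 +i* p.2.

Definition area :
    {measure set (measurableTypeR R * measurableTypeR R) -> \bar R} :=
  ((@lebesgue_measure R) \x (@lebesgue_measure R))%E.

Definition plane_continuous F : Prop :=
  continuous (fun p : R * R => complex.Re (F (plane_pt p))) /\
  continuous (fun p : R * R => complex.Im (F (plane_pt p))).

(* Derivative of a curve g : R -> C, taken componentwise. *)
Definition curve_derive (g : R -> R[i]) (t : R) : R[i] :=
  derive1 (fun s => complex.Re (g s)) t +i* derive1 (fun s => complex.Im (g s)) t.

Definition partial_x F z : R[i] :=
  curve_derive (fun s => F (s +i* complex.Im z)) (complex.Re z).

Definition partial_y F z : R[i] :=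
  curve_derive (fun s => F (complex.Re z +i* s)) (complex.Im z).

(* The Wirtinger derivatives F_z and F_{\bar z}. *)
Definition partial_z F z : R[i] := (partial_x F z - 'i * partial_y F z) / 2.

Definition partial_zbar F z : R[i] := (partial_x F z + 'i * partial_y F z) / 2.

(* Absolute continuity on [a, b]; a finite family of non-overlapping
   subintervals is a list of pairs (left endpoint, right endpoint). *)
Definition absolutely_continuous_on (a b : R) (g : R -> R[i]) : Prop :=
  forall e : R, 0 < e -> exists2 d : R, 0 < d &
    forall s : seq (R * R),
      (forall I, I \in s -> a <= I.1 /\ I.1 <= I.2 /\ I.2 <= b) ->
      pairwise (fun I J : R * R => (I.2 <= J.1) || (J.2 <= I.1)) s ->
      \sum_(I <- s) (I.2 - I.1) < d ->
      \sum_(I <- s) modulus (g I.2 - g I.1) < e.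

(* Absolute continuity on (closed segments of) almost every line parallel to
   a coordinate axis. *)
Definition ACL F : Prop :=
  forall a b : R,
    {ae (@lebesgue_measure R), forall y : R,
       absolutely_continuous_on a b (fun t => F (t +i* y))} /\
    {ae (@lebesgue_measure R), forall x : R,
       absolutely_continuous_on a b (fun t => F (x +i* t))}.

Definition locally_L2 (G : R[i] -> R[i]) : Prop :=
  forall a b c d : R,
    area.-integrable (`[a, b] `*` `[c, d])
      (fun p => (modulus (G (plane_pt p)) ^+ 2)%:E).

(* Analytic definition: a continuous ACL^2 (equivalently, continuous
   W^{1,2}_loc) map with |F_{\bar z}| <= k |F_z| a.e. for some k < 1.
   Constant maps are included. *)
Definition quasiregular F : Prop :=
  [/\ plane_continuous F,
      ACL F,
      locally_L2 (partial_x F) /\ locally_L2 (partial_y F) &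
      exists k : R, [/\ 0 <= k, k < 1 &
        {ae area, forall p : R * R,
           modulus (partial_zbar F (plane_pt p)) <=
           k * modulus (partial_z F (plane_pt p))}]].

(* By the convention w / 0 = 0, this is 0 where F_z vanishes; for a
   quasiregular F one also has F_{\bar z} = 0 at almost every such point. *)
Definition complex_dilatation F z : R[i] := partial_zbar F z / partial_z F z.

Definition dilatation_norm F : \bar R :=
  Lnorm area +oo%E (fun p => (modulus (complex_dilatation F (plane_pt p)))%:E).

(* K(F) = (1 + |mu_F|_oo) / (1 - |mu_F|_oo). The value +oo outside the range
   |mu_F|_oo < 1 never occurs for a quasiregular F. *)
Definition maximal_dilatation F : \bar R :=
  if (dilatation_norm F < 1)%E then
    ((1 + fine (dilatation_norm F)) / (1 - fine (dilatation_norm F)))%:E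
  else +oo%E.

Definition uniformly_quasiregular F : Prop :=
  quasiregular F /\
  (ereal_sup [set maximal_dilatation (iter n F) | n in [set n | (1 <= n)%N]]
     < +oo)%E.

(* Stretch by the factor K in the direction e^{i theta}; the coefficient of
   conj z is e^{2 i theta} (K - 1) / 2. *)
Definition affine_stretch (K theta : R) z : R[i] :=
  ((K + 1) / 2)%:C * z
  + (cos (2 * theta) +i* sin (2 * theta)) * ((K - 1) / 2)%:C * z^*.

End Plane.

(* Main.v *)
(* With h z = a z + b conj z, there is w <> 0 with h (w^2) = w, so z0 = w^2 is a
   fixed point of f = h^2 other than 0, where Df(z0)/2 is the real-linear map
   T v = p v + q conj v with p = w a and q = w b.  As f is homogeneous of degree
   2, T z0 = z0.  If the dilatations of all T^n v = P v + Q conj v satisfy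
   |Q| <= k |P| with k < 1, then T^n z0 = z0 keeps |P| between two positive
   constants, so det T^n = |P|^2 - |Q|^2 is bounded above and below and
   det T = 1.  Hence T is unipotent, T^n = 1 + n (T - 1), and boundedness of the
   powers forces T = 1, that is q = 0 and K = 1.  The iterates of f have
   continuous Wirtinger derivatives, so that an essential bound on their
   dilatations is also a bound at the point z0. *)
Require Import Defs.
From mathcomp Require Import all_boot all_order all_algebra.
From mathcomp Require Import all_classical all_reals all_analysis.
From mathcomp Require Import ess_sup_inf ring lra.

Set Implicit Arguments.
Unset Strict Implicit.
Unset Printing Implicit Defensive.

Import Order.TTheory GRing.Theory Num.Theory numFieldNormedType.Exports.
Import ComplexField.Normc.

Local Open Scope classical_set_scope.
Local Open Scope ring_scope.

Section Plane.
Variable R : realType.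
Implicit Types (F G : R[i] -> R[i]) (z : R[i]).

(** * Elementary properties of the modulus *)

Lemma modulus_ge0 (z : R[i]) : 0 <= modulus z.
Proof. by case: z => a b; exact: sqrtr_ge0. Qed.

Lemma modulusJ (z : R[i]) : modulus z^* = modulus z.
Proof. by case: z => a b /=; rewrite sqrrN. Qed.

Lemma modulusD (x y : R[i]) : modulus (x + y) <= modulus x + modulus y.
Proof. exact: le_normcD. Qed.

Lemma modulus_sqr (z : R[i]) : real_complex R (modulus z ^+ 2) = z * z^*.
Proof. by rewrite rmorphXn; exact: sqr_normc. Qed.

Lemma modulus_gt0 (z : R[i]) : (0 < modulus z) = (z != 0).
Proof.
rewrite lt_def modulus_ge0 andbT; congr (~~ _); apply/eqP/eqP.
  exact: eq0_normc.
by move->; exact: normc0.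
Qed.

Lemma modulus_sqrE (z : R[i]) : modulus z ^+ 2 = complex.Re z ^+ 2 + complex.Im z ^+ 2.
Proof. by case: z => a b; rewrite sqr_sqrtr// addr_ge0 ?sqr_ge0. Qed.

(* |p|^2 - |q|^2 is the determinant of the real-linear map v |-> p v + q conj v. *)
Lemma det_wirtinger_comp (p q A B : R[i]) :
  modulus (p * A + q * B^*) ^+ 2 - modulus (p * B + q * A^* ) ^+ 2 =
  (modulus p ^+ 2 - modulus q ^+ 2) * (modulus A ^+ 2 - modulus B ^+ 2).
Proof.
rewrite !modulus_sqrE; case: p q A B => [p1 p2] [q1 q2] [A1 A2] [B1 B2] /=.
ring.
Qed.

Lemma modulus_real (x : R) : modulus (real_complex R x) = `|x|.
Proof. by rewrite /= expr0n/= addr0 sqrtr_sqr. Qed.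

Lemma modulus_cis (x : R) : modulus (cos x +i* sin x)%C = 1.
Proof. by rewrite /= cos2Dsin2 sqrtr1. Qed.

(** * Real-linear maps of the plane with a fixed vector and bounded dilatation of all powers *)

Lemma bounded_powers_le1 (x M : R) : (forall n, x ^+ n <= M) -> x <= 1.
Proof.
move=> H; rewrite leNgt; apply/negP => x1.
have [n nM] : exists n : nat, M < n%:R * (x - 1).
  exists (Num.truncn (M / (x - 1))).+1.
  by rewrite -ltr_pdivrMr ?subr_gt0// truncnS_gt.
have := H n.
(* A weak form of Bernoulli's inequality, which makes the powers of [x > 1] unbounded. *)
have : n%:R * (x - 1) <= x ^+ n.
  elim: n {nM} => [|n IH]; first by rewrite mul0r expr0.
  rewrite exprS -natr1 mulrDl mul1r.
  have : 1 <= x ^+ n by apply: exprn_ege1; lra.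
  nra.
lra.
Qed.

(** [A n] and [B n] are the coefficients of [T^n], where [T v = p v + q conj v]. The condition on
    [modulus q] and [modulus p] makes [det T] positive, so that the powers of both [det T] and its
    inverse can be bounded. *)
Lemma quasiconformal_iterates_conformal (p q z0 : R[i]) (A B : nat -> R[i]) (k : R) :
  z0 != 0 -> p * z0 + q * z0^* = z0 -> modulus q < modulus p ->
  A 0%N = 1 -> B 0%N = 0 ->
  (forall n, A n.+1 = p * A n + q * (B n)^* ) ->
  (forall n, B n.+1 = p * B n + q * (A n)^* ) ->
  0 <= k -> k < 1 ->
  (forall n, modulus (B n) <= k * modulus (A n)) -> q = 0.
Proof.
move=> z00 Tz0 qp A0 B0 AS BS k0 k1 BA.
have fixn n : A n * z0 + B n * (z0)^* = z0.
  elim: n => [|n IH]; first by rewrite A0 B0; ring.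
  rewrite AS BS -[RHS]Tz0 -[in RHS]IH.
  by rewrite !(rmorphD, rmorphM)/= !conjCK; ring.
have z0gt : 0 < modulus z0 by rewrite modulus_gt0.
(* From [T^n z0 = z0]: [|A| |z0| <= |z0| + |B| |z0|], and [|B| <= k |A|] absorbs the last term. *)
have Aup n : modulus (A n) <= (1 - k)^-1.
  rewrite -[X in _ <= X]mul1r ler_pdivlMr; last by lra.
  rewrite -(ler_pM2r z0gt) mul1r.
  have : modulus (A n * z0) <= modulus z0 + modulus (- (B n * z0^*)).
    by rewrite -[in leLHS](addrK (B n * z0^*) (A n * z0)) fixn modulusD.
  rewrite normcN !normcM modulusJ.
  have := ler_wpM2r (ltW z0gt) (BA n).
  lra.
have Alow n : 1 <= 2 * modulus (A n).
  rewrite -(ler_pM2r z0gt) mul1r -[in leLHS](fixn n).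
  apply: (le_trans (modulusD _ _)).
  rewrite !normcM modulusJ.
  have := ler_wpM2r (ltW z0gt) (BA n).
  have : 0 <= modulus (A n) * modulus z0 by rewrite mulr_ge0 ?modulus_ge0.
  nra.
set d := modulus p ^+ 2 - modulus q ^+ 2.
have detn n : modulus (A n) ^+ 2 - modulus (B n) ^+ 2 = d ^+ n.
  elim: n => [|n IH].
    by rewrite A0 B0 normc1 normc0 (expr0 d); ring.
  by rewrite AS BS det_wirtinger_comp IH (exprS d).
have d0 : 0 < d by rewrite /d subr_gt0 ltr_pXn2r ?nnegrE ?modulus_ge0.
have dup : d <= 1.
  apply: (@bounded_powers_le1 _ ((1 - k)^-1 ^+ 2)) => n; rewrite -detn.
  apply: (@le_trans _ _ (modulus (A n) ^+ 2)); first by rewrite gerBl sqr_ge0.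
  by rewrite ler_pXn2r ?nnegrE ?modulus_ge0 ?Aup// invr_ge0; lra.
(* Here [d ^+ n >= (1 - k ^+ 2) |A n|^2 >= (1 - k ^+ 2) / 4], by [Alow]. *)
have dlow : d^-1 <= 1.
  apply: (@bounded_powers_le1 _ (4 / (1 - k ^+ 2))) => n; rewrite exprVn.
  have k2 : 0 < 1 - k ^+ 2 by nra.
  rewrite -[_ / _]invrK lef_pV2 ?posrE ?exprn_gt0 ?invr_gt0 ?divr_gt0//.
  rewrite invf_div ler_pdivrMr//.
  rewrite -detn.
  have : modulus (B n) ^+ 2 <= k ^+ 2 * modulus (A n) ^+ 2.
    by rewrite -exprMn ler_pXn2r ?nnegrE ?mulr_ge0 ?modulus_ge0.
  have : 1 / 4 <= modulus (A n) ^+ 2 by have := Alow n; nra.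
  set x := _ ^+ 2; set y := _ ^+ 2; set z := k ^+ 2 in k2 * => x4 yx.
  have : 0 <= (1 - z) * (x - 1 / 4) by apply: mulr_ge0; lra.
  lra.
have d1 : d = 1.
  apply/eqP; rewrite eq_le dup /=.
  by rewrite -[d]invrK invf_ge1 ?invr_gt0.
have pq : p * p^* - q * q^* = 1.
  by rewrite -!modulus_sqr -rmorphB -/d d1 rmorph1.
(* The fixed vector gives [(1 - p) z0 = q conj z0]; compare moduli. *)
have pq1 : (p - 1) * (p - 1)^* = q * q^*.
  rewrite -!modulus_sqr; congr (real_complex R (_ ^+ 2)).
  apply: (mulIf (lt0r_neq0 z0gt)).
  rewrite -{2}(modulusJ z0) -!normcM -[in RHS]normcN; congr modulus.
  by rewrite mulrBl mul1r -{2}Tz0; ring.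
(* The difference of [pq] and [pq1] is [p + conj p = 2]: the trace of [T] is 2. *)
have uJ : (p - 1)^* = - (p - 1).
  move: pq pq1; rewrite !rmorphB rmorph1 => pq pq1.
  have e : p * p^* - 1 - (p - 1) * (p^* - 1) = 0 by rewrite pq1 -pq; ring.
  by apply/eqP; rewrite -subr_eq0 -e; apply/eqP; ring.
(* With [N = T - 1], [pq1] and [uJ] give [N^2 = 0], hence [T^n = 1 + n N]. *)
have AB n : A n = 1 + n%:R * (p - 1) /\ B n = n%:R * q.
  elim: n => [|n [IA IB]]; first by rewrite A0 B0; split; ring.
  rewrite AS BS IA IB.
  have -> : (1 + n%:R * (p - 1))^* = 1 - n%:R * (p - 1).
    by rewrite rmorphD rmorphM/= rmorph1 rmorph_nat uJ mulrN.
  have -> : (n%:R * q)^* = n%:R * q^* by rewrite rmorphM/= rmorph_nat.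
  have e : q * q^* = - (p - 1) ^+ 2 by rewrite -pq1 uJ; ring.
  split; last by rewrite -natr1; ring.
  rewrite (_ : q * (n%:R * q^*) = n%:R * (q * q^*)); last by ring.
  by rewrite e -natr1; ring.
(* Otherwise [n |q| = |B n| <= |A n|] would exceed the bound [Aup] for large [n]. *)
apply/eqP; apply: contraT => qn0.
have [n] : exists n : nat, (1 - k)^-1 < n%:R * modulus q.
  exists (Num.truncn ((1 - k)^-1 / modulus q)).+1.
  by rewrite -ltr_pdivrMr ?modulus_gt0// truncnS_gt.
have := Aup n; have := BA n; rewrite (AB n).2.
rewrite (_ : n%:R * q = q *+ n) ?normcMn; last by rewrite mulr_natl.
rewrite -mulr_natl; have := modulus_ge0 (A n); nra.
Qed.

(** * A nonzero fixed point of the squared stretch *)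

(** Since [h] is real-linear, putting [w = r e^(i x)] with [r] real reduces the equation to
    [h(e^(2 i x)) = r^-1 e^(i x)]. It suffices that [e^(-i x) h(e^(2 i x))] be real and nonzero; the
    intermediate value theorem gives an [x] where its imaginary part vanishes. *)
Lemma affine_square_fixed_point (K theta : R) : 0 < K ->
  exists2 w : R[i], w != 0 & affine_stretch K theta (w ^+ 2) = w.
Proof.
move=> K0.
(* [c x + i g x = e^(-i x) h(e^(2 i x))]: where g vanishes, w = e^(i x) / c x
   works, whatever the sign of c x. *)
pose g (x : R) := (K + 1) / 2 * sin x + (K - 1) / 2 * sin (2 * theta - 3 * x).
pose c (x : R) := (K + 1) / 2 * cos x + (K - 1) / 2 * cos (2 * theta - 3 * x).
have cg : continuous g.
  move=> x; apply: cvgD; apply: cvgM; try exact: cvg_cst.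
    exact: continuous_sin.
  apply: continuous_comp; last exact: continuous_sin.
  by apply: cvgB; [exact: cvg_cst|apply: cvgM; [exact: cvg_cst|exact: cvg_id]].
have [|||x _ gx0] := @IVT R g (- (pi / 2)) (pi / 2) 0.
- by have := pi_ge0 R; lra.
- exact: continuous_subspaceT.
(* At the endpoints the first term is [-(K + 1) / 2] and [(K + 1) / 2]; it fixes the sign because
   [|K - 1| < K + 1]. *)
- rewrite /g sinN sin_pihalf.
  set s1 := sin (_ - _); set s2 := sin (_ - _).
  have : -1 <= s1 <= 1 by rewrite sin_geN1 sin_le1.
  have : -1 <= s2 <= 1 by rewrite sin_geN1 sin_le1.
  move=> /andP[? ?] /andP[? ?].
  rewrite ge_min le_max; apply/andP; split; apply/orP; [left|right]; nra.
(* The sum [c^2 + g^2] is [|h(e^(2 i x))|^2], that is [((1 + y) K^2 + (1 - y)) / 2] with [y] a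
   cosine, so it cannot vanish for [K > 0]. *)
have cx0 : c x != 0.
  apply/eqP => cx0.
  have e : c x ^+ 2 + g x ^+ 2 = ((K + 1) / 2) ^+ 2 + ((K - 1) / 2) ^+ 2 +
      2 * ((K + 1) / 2) * ((K - 1) / 2) * cos (2 * theta - 3 * x - x).
    rewrite cosB /c /g; have := cos2Dsin2 x; have := cos2Dsin2 (2 * theta - 3 * x).
    move: (cos _) (sin _) (cos x) (sin x) => C S C' S' E1 E2.
    transitivity (((K + 1) / 2) ^+ 2 * (C' ^+ 2 + S' ^+ 2) +
      ((K - 1) / 2) ^+ 2 * (C ^+ 2 + S ^+ 2) +
      2 * ((K + 1) / 2) * ((K - 1) / 2) * (C * C' + S * S')); first by ring.
    by rewrite E1 E2 !mulr1.
  have := cos_geN1 (2 * theta - 3 * x - x).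
  have := cos_le1 (2 * theta - 3 * x - x).
  rewrite gx0 cx0 in e; move: e; set y := cos _ => e y1 y2.
  have : (1 + y) * K ^+ 2 + (1 - y) = 0.
    transitivity (2 * (0 ^+ 2 + 0 ^+ 2 : R)); last by ring.
    by rewrite e; field.
  have K2 : 0 < K ^+ 2 by rewrite exprn_gt0.
  move=> s0; have yK : 0 <= (1 + y) * K ^+ 2 by rewrite mulr_ge0 ?(ltW K2)//; lra.
  have y1' : y = 1 by lra.
  by move: s0; rewrite y1'; lra.
have cos2 : cos (2 * x) = cos x ^+ 2 - sin x ^+ 2.
  by rewrite (_ : 2 * x = x + x) ?cosD; ring.
have sin2 : sin (2 * x) = 2 * cos x * sin x.
  by rewrite (_ : 2 * x = x + x) ?sinD; ring.
(* Splitting [2 theta - 2 x] as [(2 theta - 3 x) + x] factors [h(e^(2 i x))] as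
   [e^(i x) (c x + i g x)]; [re] and [im] are the two components of this identity at the zero of
   [g]. *)
have cos22 := cosB (2 * theta) (2 * x); have sin22 := sinB (2 * theta) (2 * x).
rewrite cos2 sin2 in cos22 sin22.
rewrite (_ : 2 * theta - 2 * x = (2 * theta - 3 * x) + x) ?(cosD (_ - _) x) in cos22; last by ring.
rewrite (_ : 2 * theta - 2 * x = (2 * theta - 3 * x) + x) ?(sinD (_ - _) x) in sin22; last by ring.
have re : (K + 1) / 2 * (cos x ^+ 2 - sin x ^+ 2) + (K - 1) / 2 *
    (cos (2 * theta) * (cos x ^+ 2 - sin x ^+ 2) +
     sin (2 * theta) * (2 * cos x * sin x)) = c x * cos x.
  transitivity (c x * cos x - g x * sin x); last by rewrite gx0; ring.
  by rewrite -cos22 /c /g; ring.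
have im : (K + 1) / 2 * (2 * cos x * sin x) + (K - 1) / 2 *
    (sin (2 * theta) * (cos x ^+ 2 - sin x ^+ 2) -
     cos (2 * theta) * (2 * cos x * sin x)) = c x * sin x.
  transitivity (c x * sin x + g x * cos x); last by rewrite gx0; ring.
  by rewrite -sin22 /c /g; ring.
exists ((c x)^-1 * cos x +i* ((c x)^-1 * sin x))%C.
  apply/eqP => -[/eqP + /eqP]; rewrite !mulf_eq0 invr_eq0 (negbTE cx0)/=.
  move=> /eqP cx /eqP sx; have := cos2Dsin2 x; rewrite cx sx; lra.
rewrite /affine_stretch expr2; simpc; congr Complex.
  transitivity ((c x)^-1 ^+ 2 * (c x * cos x)); last by field.
  by rewrite -re; field.
transitivity ((c x)^-1 ^+ 2 * (c x * sin x)); last by field.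
by rewrite -im; field.
Qed.

(** * Differentiation of curves in the plane *)

Lemma ReD (x y : R[i]) : complex.Re (x + y) = complex.Re x + complex.Re y.
Proof. by case: x y => [? ?] [? ?]. Qed.

Lemma ImD (x y : R[i]) : complex.Im (x + y) = complex.Im x + complex.Im y.
Proof. by case: x y => [? ?] [? ?]. Qed.

Lemma ReM (x y : R[i]) :
  complex.Re (x * y) = complex.Re x * complex.Re y - complex.Im x * complex.Im y.
Proof. by case: x y => [? ?] [? ?]. Qed.

Lemma ImM (x y : R[i]) :
  complex.Im (x * y) = complex.Re x * complex.Im y + complex.Im x * complex.Re y.
Proof. by case: x y => [? ?] [? ?]. Qed.

(** A relation, since it must assert differentiability too; the total function [curve_derive] gives
    only a value. *)
Definition has_curve_derive (g : R -> R[i]) (t : R) (d : R[i]) :=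
  is_derive t 1 (fun s => complex.Re (g s)) (complex.Re d) /\
  is_derive t 1 (fun s => complex.Im (g s)) (complex.Im d).

Lemma curve_deriveE g t d : has_curve_derive g t d -> curve_derive g t = d.
Proof.
move=> [H1 H2]; rewrite /curve_derive !derive1E !derive_val.
by case: d H1 H2.
Qed.

Lemma has_curve_deriveD g1 g2 t d1 d2 :
  has_curve_derive g1 t d1 -> has_curve_derive g2 t d2 ->
  has_curve_derive (fun s => g1 s + g2 s) t (d1 + d2).
Proof.
move=> [H1 H2] [H3 H4]; split; rewrite raddfD.
- rewrite (_ : (fun s => _) = (fun s => complex.Re (g1 s)) + (fun s => complex.Re (g2 s))).
    exact: is_deriveD.
  by apply/funext => s; rewrite raddfD.
- rewrite (_ : (fun s => _) = (fun s => complex.Im (g1 s)) + (fun s => complex.Im (g2 s))).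
    exact: is_deriveD.
  by apply/funext => s; rewrite raddfD.
Qed.

Lemma has_curve_deriveM g1 g2 t d1 d2 :
  has_curve_derive g1 t d1 -> has_curve_derive g2 t d2 ->
  has_curve_derive (fun s => g1 s * g2 s) t (g1 t * d2 + g2 t * d1).
Proof.
move=> [H1 H2] [H3 H4]; split.
- rewrite (_ : (fun s => _) = (fun s => complex.Re (g1 s)) * (fun s => complex.Re (g2 s))
    - (fun s => complex.Im (g1 s)) * (fun s => complex.Im (g2 s))); last first.
    by apply/funext => s; rewrite ReM.
  by apply: is_derive_eq; rewrite ReD !(ReM (g1 _)) !(ReM (g2 _)) /GRing.scale/=; ring.
- rewrite (_ : (fun s => _) = (fun s => complex.Re (g1 s)) * (fun s => complex.Im (g2 s))
    + (fun s => complex.Im (g1 s)) * (fun s => complex.Re (g2 s))); last first.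
    by apply/funext => s; rewrite ImM.
  by apply: is_derive_eq; rewrite ImD !(ImM (g1 _)) !(ImM (g2 _)) /GRing.scale/=; ring.
Qed.

Lemma has_curve_derive_cst c t : has_curve_derive (fun=> c) t 0.
Proof. by split; exact: is_derive_cst. Qed.

Lemma has_curve_deriveJ g t d :
  has_curve_derive g t d -> has_curve_derive (fun s => (g s)^* ) t d^*.
Proof.
move=> [H1 H2]; split.
- have -> : complex.Re d^* = complex.Re d by case: (d).
  rewrite (_ : (fun s => _) = fun s => complex.Re (g s)) //.
  by apply/funext => s; case: (g s).
- have -> : complex.Im d^* = - complex.Im d by case: (d).
  rewrite (_ : (fun s => _) = - fun s => complex.Im (g s)); last first.
    by apply/funext => s; rewrite /GRing.opp/=; case: (g s).
  exact: is_deriveN.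
Qed.

(** * Continuous maps of the plane and Wirtinger derivatives *)

Lemma plane_continuousD (F G : R[i] -> R[i]) :
  plane_continuous F -> plane_continuous G -> plane_continuous (fun z => F z + G z).
Proof.
move=> [F1 F2] [G1 G2]; split => p.
- under eq_fun do rewrite raddfD.
  by apply: cvgD; [exact: F1|exact: G1].
- under eq_fun do rewrite raddfD.
  by apply: cvgD; [exact: F2|exact: G2].
Qed.

Lemma plane_continuousM (F G : R[i] -> R[i]) :
  plane_continuous F -> plane_continuous G -> plane_continuous (fun z => F z * G z).
Proof.
move=> [F1 F2] [G1 G2]; split => p.
- under eq_fun do rewrite ReM.
  by apply: cvgB; apply: cvgM; [exact: F1|exact: G1|exact: F2|exact: G2].
- under eq_fun do rewrite ImM.
  by apply: cvgD; apply: cvgM; [exact: F1|exact: G2|exact: F2|exact: G1].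
Qed.

Lemma plane_continuousJ (F : R[i] -> R[i]) :
  plane_continuous F -> plane_continuous (fun z => (F z)^* ).
Proof.
move=> [F1 F2]; split.
- rewrite (_ : (fun p => _) = fun p => complex.Re (F (plane_pt p))) //.
  by apply/funext => p; case: (F _).
- rewrite (_ : (fun p => _) = fun p => - complex.Im (F (plane_pt p))) //.
    by move=> p; apply: cvgN; exact: F2.
  by apply/funext => p; case: (F _).
Qed.

Lemma plane_continuous_cst c : plane_continuous (fun=> c : R[i]).
Proof. by split => p; exact: cvg_cst. Qed.

Lemma plane_continuous_id : plane_continuous (fun z : R[i] => z).
Proof. by split => p; [exact: cvg_fst|exact: cvg_snd]. Qed.

Lemma plane_continuous_modulus F : plane_continuous F ->
  continuous (fun p : R * R => modulus (F (plane_pt p))).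
Proof.
move=> [F1 F2] p.
rewrite (_ : (fun p => _) = fun p => Num.sqrt (complex.Re (F (plane_pt p)) ^+ 2 +
  complex.Im (F (plane_pt p)) ^+ 2)); last first.
  by apply/funext => q; case: (F _).
apply: continuous_comp; last exact: sqrt_continuous.
apply: cvgD; under eq_fun do rewrite expr2; apply: cvgM; by [exact: F1|exact: F2].
Qed.

(* Stated along differentiable curves, which makes the chain rule for iterates
   immediate. *)
Definition is_wirtinger F z A B : Prop :=
  forall (g : R -> R[i]) t d, g t = z -> has_curve_derive g t d ->
    has_curve_derive (fun s => F (g s)) t (A * d + B * d^* ).

(** Horizontal and vertical lines are curves with derivatives [1] and ['i], so [F_x = A + B] and
    [F_y = 'i (A - B)]; solve for [A] and [B]. *)
Lemma partials_wirtinger F z A B : is_wirtinger F z A B ->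
  partial_z F z = A /\ partial_zbar F z = B.
Proof.
move=> FAB.
have dx : partial_x F z = A + B.
  rewrite -[RHS](_ : A * 1 + B * 1^* = _); last by rewrite rmorph1; ring.
  apply: curve_deriveE; apply: (FAB (fun s => s +i* complex.Im z)%C).
    by case: (z).
  by split => /=; [exact: is_derive_id|exact: is_derive_cst].
have dy : partial_y F z = A * 'i - B * 'i.
  rewrite -[RHS](_ : A * 'i + B * 'i^* = _); last by rewrite conjCi; ring.
  apply: curve_deriveE; apply: (FAB (fun s => complex.Re z +i* s)%C).
    by case: (z).
  by split => /=; [exact: is_derive_cst|exact: is_derive_id].
rewrite /partial_z /partial_zbar dx dy.
have i2 : 'i ^+ 2 = -1 :> R[i] := sqrCi _.
have e : 'i * (A * 'i - B * 'i) = B - A.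
  by transitivity ('i ^+ 2 * (A - B)); [|rewrite i2]; ring.
by rewrite e; split; field.
Qed.

(** * Wirtinger derivatives of the iterates of the affine square *)

Section IteratedAffineSquare.
Variables a b : R[i].
Let h z := a * z + b * z^*.

Lemma wirtinger_square z :
  is_wirtinger (fun z => h z ^+ 2) z (2 * h z * a) (2 * h z * b).
Proof.
move=> g t d gt gd.
have hd : has_curve_derive (fun s => h (g s)) t (h d).
  rewrite /h; have c1 := has_curve_derive_cst a t; have c2 := has_curve_derive_cst b t.
  have := has_curve_deriveD (has_curve_deriveM c1 gd)
    (has_curve_deriveM c2 (has_curve_deriveJ gd)).
  by rewrite !mulr0 !addr0.
have := has_curve_deriveM hd hd; rewrite gt.
by rewrite (_ : _ + _ = 2 * h z * a * d + 2 * h z * b * d^*); last by rewrite /h; ring.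
Qed.

Let f z := h z ^+ 2.

(** The chain rule for [f o F], with [F] the [m]-th iterate: [w a] and [w b] are the Wirtinger
    derivatives of [f] at [F z], and [A], [B] those of [F] at [z]. *)
Fixpoint iter_wirtinger (n : nat) z : R[i] * R[i] :=
  if n is m.+1 then
    let w := 2 * h (iter m f z) in let: (A, B) := iter_wirtinger m z in
    (w * a * A + w * b * B^*, w * a * B + w * b * A^* )
  else (1, 0).

Lemma iter_wirtingerP n z :
  is_wirtinger (iter n f) z (iter_wirtinger n z).1 (iter_wirtinger n z).2.
Proof.
elim: n => [|n IH] g t d gt gd /=; first by rewrite mul1r mul0r addr0.
case: (iter_wirtinger n z) IH => A B /= IH.
have := @wirtinger_square (iter n f z) (fun s => iter n f (g s)) t _ _ (IH g t d gt gd).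
rewrite gt => /(_ erefl); congr has_curve_derive.
by rewrite !(rmorphD, rmorphM)/= conjCK; ring.
Qed.

Lemma plane_continuous_iter n : plane_continuous (iter n f).
Proof.
elim: n => [|n IH]; first exact: plane_continuous_id.
have hc : plane_continuous (fun z => h (iter n f z)).
  by apply: plane_continuousD; apply: plane_continuousM;
    do ?[exact: plane_continuous_cst|exact: plane_continuousJ].
exact: plane_continuousM.
Qed.

Lemma plane_continuous_iter_wirtinger n :
  plane_continuous (fun z => (iter_wirtinger n z).1) /\
  plane_continuous (fun z => (iter_wirtinger n z).2).
Proof.
elim: n => [|n [IA IB]]; first by split; exact: plane_continuous_cst.
have hc : plane_continuous (fun z => 2 * h (iter n f z)).
  apply: plane_continuousM; first exact: plane_continuous_cst.
  by apply: plane_continuousD; apply: plane_continuousM;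
    do ?[exact: plane_continuous_cst|apply: plane_continuousJ|exact: plane_continuous_iter].
split.
- rewrite (_ : (fun z => _) = fun z => 2 * h (iter n f z) * a * (iter_wirtinger n z).1
    + 2 * h (iter n f z) * b * (iter_wirtinger n z).2^*); last first.
    by apply/funext => z /=; case: iter_wirtinger.
  by apply: plane_continuousD; do !apply: plane_continuousM => //;
    do ?[exact: plane_continuous_cst|exact: plane_continuousJ].
- rewrite (_ : (fun z => _) = fun z => 2 * h (iter n f z) * a * (iter_wirtinger n z).2
    + 2 * h (iter n f z) * b * (iter_wirtinger n z).1^*); last first.
    by apply/funext => z /=; case: iter_wirtinger.
  by apply: plane_continuousD; do !apply: plane_continuousM => //;
    do ?[exact: plane_continuous_cst|exact: plane_continuousJ].
Qed.

(** Jacobians multiply along the orbit, and that of [f] is nonnegative. Consequently the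
    zbar-derivative vanishes wherever the z-derivative does. *)
Lemma iter_wirtinger_le n z : modulus b <= modulus a ->
  modulus (iter_wirtinger n z).2 <= modulus (iter_wirtinger n z).1.
Proof.
move=> ba; elim: n => [|n IH]; first by rewrite [leLHS]normc0 modulus_ge0.
rewrite /=.
case: (iter_wirtinger n z) IH => A B /= AB.
rewrite -(@ler_pXn2r _ 2)// ?nnegrE ?modulus_ge0// -subr_ge0 det_wirtinger_comp.
rewrite mulr_ge0// subr_ge0 ler_pXn2r ?nnegrE ?modulus_ge0//.
by rewrite !normcM ler_wpM2l// mulr_ge0 ?modulus_ge0.
Qed.

End IteratedAffineSquare.

(** * From essential to pointwise bounds on the dilatation *)

Lemma ae_area_open_meets (U : set (R * R)) (P : R * R -> Prop) (p : R * R) :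
  open U -> U p -> {ae @area R, forall q, P q} -> exists2 q, U q & P q.
Proof.
move=> oU Up [N [mN N0 PN]]; apply: contrapT => nex.
have [e /= e0 sub] : nbhs_ball p U by apply/nbhs_ballP; apply: open_nbhs_nbhs.
(* If [P] failed on all of [U], the null set [N] would contain a square of side [2 e], whose area is
   positive. *)
have subN : ball p.1 e `*` ball p.2 e `<=` N.
  move=> q [q1 q2]; apply: PN => Pq; apply: nex; exists q => //.
  exact: sub.
have mB (x : R) : measurable (ball x e : set (measurableTypeR R)).
  by rewrite ball_itv; exact: measurable_itv.
have : (@area R (ball p.1 e `*` ball p.2 e) <= @area R N)%E.
  by apply: le_measure => //; rewrite inE//; exact: measurableX.
rewrite N0 /area /= product_measure1E//.
have L (x : R) : (@lebesgue_measure R (ball x e) = (e *+ 2)%:E)%E.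
  rewrite ball_itv lebesgue_measure_itv/= lte_fin ifT; last by lra.
  by rewrite -EFinB; congr EFin; lra.
rewrite [X in (X * _)%E]L [X in (_ * X)%E]L -EFinM lee_fin.
suff : 0 < e *+ 2 * (e *+ 2) by lra.
by rewrite mulr_gt0 // mulrn_wgt0.
Qed.

(** The norm with exponent [+oo] unfolds to an essential supremum only when the whole space has
    positive measure. *)
Lemma area_setT_gt0 : (0 < @area R setT)%E.
Proof.
rewrite lt0e measure_ge0 andbT; apply/eqP => a0.
have [] := @ae_area_open_meets setT (fun=> False) (0, 0) openT I => //.
by exists setT; split.
Qed.

Lemma dilatation_norm_ge0 (F : R[i] -> R[i]) : (0 <= dilatation_norm F)%E.
Proof. exact: Lnorm_ge0. Qed.

Lemma dilatation_bound (F : R[i] -> R[i]) (k : R) : (dilatation_norm F <= k%:E)%E ->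
  {ae @area R, forall p, modulus (complex_dilatation F (plane_pt p)) <= k}.
Proof.
rewrite /dilatation_norm unlock area_setT_gt0 => /ess_supP.
apply: filterS => p; rewrite /= lee_fin; exact/le_trans/ler_norm.
Qed.

(** The map [t |-> (1 + t) / (1 - t)] is increasing on [[0, 1)], with inverse
    [M |-> (M - 1) / (M + 1)]. *)
Lemma maximal_dilatation_bound (F : R[i] -> R[i]) (M : R) : 1 <= M ->
  (maximal_dilatation F <= M%:E)%E -> (dilatation_norm F <= ((M - 1) / (M + 1))%:E)%E.
Proof.
move=> M1; rewrite /maximal_dilatation; case: ifPn => // lt1.
have := dilatation_norm_ge0 F; case: (dilatation_norm F) lt1 => //= x.
rewrite !lte_fin !lee_fin => x1 x0.
rewrite ler_pdivrMr ?subr_gt0// ler_pdivlMr; lra.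
Qed.

(** By continuity a failure at one point spreads to an open set, which meets the set of full measure
    where the essential bound holds. *)
Lemma pointwise_dilatation_bound (F A B : R[i] -> R[i]) (k : R) :
  (forall z, partial_z F z = A z) -> (forall z, partial_zbar F z = B z) ->
  continuous (fun p : R * R => modulus (A (plane_pt p))) ->
  continuous (fun p : R * R => modulus (B (plane_pt p))) ->
  (forall z, modulus (B z) <= modulus (A z)) ->
  0 <= k -> (dilatation_norm F <= k%:E)%E ->
  forall z, modulus (B z) <= k * modulus (A z).
Proof.
move=> FA FB cA cB BA k0 /dilatation_bound Fk z; rewrite leNgt; apply/negP => zk.
pose U := [set p : R * R | 0 < modulus (B (plane_pt p)) - k * modulus (A (plane_pt p))].
have oU : open U.
  apply: (open_comp _ (@open_gt R 0)) => p _.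
  by apply: cvgB; [exact: cB|apply: cvgM; [exact: cvg_cst|exact: cA]].
have Uz : U (complex.Re z, complex.Im z).
  by rewrite /U/= subr_gt0 /plane_pt/=; case: (z) zk.
have [p] := ae_area_open_meets oU Uz Fk.
rewrite /U [U in U -> _]/= subr_gt0 => pk; rewrite /complex_dilatation FA FB.
(* On [U], [|A| >= |B| > k |A| >= 0], so the quotient is a genuine one and not the default value at
   a zero denominator. *)
have A0 : 0 < modulus (A (plane_pt p)).
  by apply: lt_le_trans (BA _); apply: le_lt_trans pk; rewrite mulr_ge0 ?modulus_ge0.
rewrite normcM normcV ler_pdivrMr//.
lra.
Qed.

Lemma uniformly_quasiregular_bound F : uniformly_quasiregular F ->
  exists k : R, [/\ 0 <= k, k < 1 &
    forall n, (0 < n)%N -> (dilatation_norm (iter n F) <= k%:E)%E].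
Proof.
move=> [_]; set S := ereal_sup _ => Soo.
(* The maximum with 1 ensures that [(M - 1) / (M + 1)] is nonnegative. *)
set M : R := Num.max 1 (fine S).
have M1 : 1 <= M by rewrite le_max lexx.
have SM : (S <= M%:E)%E.
  rewrite /M; clear M M1; case: S Soo => [r _|//|_]; last exact: leNye.
  by rewrite lee_fin le_max lexx orbT.
exists ((M - 1) / (M + 1)); split.
- by clear Soo SM; apply: divr_ge0; lra.
- by clear Soo SM; rewrite ltr_pdivrMr; lra.
move=> n n0; apply: maximal_dilatation_bound => //; apply: le_trans SM.
by apply: ereal_sup_ubound; exists n.
Qed.

End Plane.

(** * The derivatives of the iterates at the nonzero fixed point *)

Theorem theorem2p7 (R : realType) (K theta : R) (hK : 0 < K) (hK1 : K != 1) :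
  ~ uniformly_quasiregular (fun z : R[i] => affine_stretch K theta z ^+ 2).
Proof.
move=> /uniformly_quasiregular_bound[k [k0 k1 Hk]].
pose a : R[i] := real_complex R ((K + 1) / 2).
pose b : R[i] := (cos (2 * theta) +i* sin (2 * theta))%C * real_complex R ((K - 1) / 2).
have mb : modulus b = `|(K - 1) / 2|.
  by rewrite normcM modulus_cis modulus_real mul1r.
have ba : modulus b < modulus a.
  rewrite mb modulus_real [ltRHS]ger0_norm; last by lra.
  by rewrite ltr_norml; apply/andP; split; lra.
have [w w0 hw] := affine_square_fixed_point theta hK.
pose z0 := w ^+ 2.
have fixn n : iter n (fun z : R[i] => affine_stretch K theta z ^+ 2) z0 = z0.
  by elim: n => //= n ->; rewrite hw.
pose A n := (iter_wirtinger a b n z0).1; pose B n := (iter_wirtinger a b n z0).2.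
have BA n : modulus (B n) <= k * modulus (A n).
  (* The dilatation bound covers only positive iterates; for [n = 0], the identity, [B] is zero. *)
  case: n => [|n].
    by rewrite [leLHS]normc0 mulr_ge0 ?modulus_ge0.
  have W z := partials_wirtinger (@iter_wirtingerP R a b n.+1 z).
  have [cA cB] := plane_continuous_iter_wirtinger a b n.+1.
  apply: (@pointwise_dilatation_bound _ (iter n.+1 (fun z : R[i] => affine_stretch K theta z ^+ 2))
    (fun z => (iter_wirtinger a b n.+1 z).1) (fun z => (iter_wirtinger a b n.+1 z).2)) => //.
  - by move=> z; exact: (W z).1.
  - by move=> z; exact: (W z).2.
  - exact: (plane_continuous_modulus cA).
  - exact: (plane_continuous_modulus cB).
  - by move=> z; exact/iter_wirtinger_le/ltW.
  - exact: Hk.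
(* The orbit of [z0] is constant and [h z0 = w], so the chain rule has constant coefficients [2 w a]
   and [2 w b]. *)
have AS n : A n.+1 = 2 * w * a * A n + 2 * w * b * (B n)^*.
  rewrite /A /B /= -[iter n _ z0]/(iter n (fun z => affine_stretch K theta z ^+ 2) z0) fixn.
  by rewrite -hw; case: iter_wirtinger.
have BS n : B n.+1 = 2 * w * a * B n + 2 * w * b * (A n)^*.
  rewrite /A /B /= -[iter n _ z0]/(iter n (fun z => affine_stretch K theta z ^+ 2) z0) fixn.
  by rewrite -hw; case: iter_wirtinger.
have conj2 n (z : R[i]) : (z / 2 ^+ n)^* = z^* / 2 ^+ n.
  by rewrite rmorphM/= fmorphV/= rmorphXn/= rmorph_nat.
have e2 n : (2 : R[i]) ^+ n != 0 by rewrite expf_neq0.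
have wgt : 0 < modulus w by rewrite modulus_gt0.
have : w * b = 0.
  (* Dividing by [2 ^+ n] replaces [Df(z0)] by [T = Df(z0) / 2], which fixes [z0], and leaves the
     dilatations unchanged. *)
  apply: (@quasiconformal_iterates_conformal R (w * a) (w * b) z0
    (fun n => A n / 2 ^+ n) (fun n => B n / 2 ^+ n) k) => //.
  - by rewrite expf_neq0.
  - transitivity (w * affine_stretch K theta z0); last by rewrite hw.
    by rewrite /affine_stretch -/a -/b; ring.
  - by rewrite (normcM w b) (normcM w a) ltr_pM2l.
  - by rewrite divr1.
  - by rewrite divr1.
  - by move=> n; rewrite AS conj2 exprS; field; rewrite e2.
  - by move=> n; rewrite BS conj2 exprS; field; rewrite e2.
  - by move=> n; rewrite !normcM mulrA ler_wpM2r ?modulus_ge0.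
move=> /(congr1 (fun z : R[i] => modulus z)).
rewrite (normcM w b) mb normc0 => /eqP.
rewrite mulf_eq0 (gt_eqF wgt)/= normr_eq0 => /eqP Kb.
by move/eqP: hK1; lra.
Qed.
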